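(* Let $k$ be a positive integer and consider the $k$-th order system of two rational difference equations $$x_n=\frac{\alpha+\sum^{k}_{i=1}\beta_{i}x_{n-i} + \sum^{k}_{i=1}\gamma_{i}y_{n-i}}{A+\sum^{k}_{j=1}B_{j}x_{n-j} + \sum^{k}_{j=1}C_{j}y_{n-j}},\qquad y_n=\frac{p+\sum^{k}_{i=1}\delta_{i}x_{n-i} + \sum^{k}_{i=1}\epsilon_{i}y_{n-i}}{q+\sum^{k}_{j=1}D_{j}x_{n-j} + \sum^{k}_{j=1}E_{j}y_{n-j}},\qquad n\in\mathbb{N},$$ with non-negative real parameters and non-negative initial conditions. Assume that there exist constants $M_1,M_2>0$ such that every solution satisfies $M_1y_n\le x_n\le M_2y_n$ for all $n\in\mathbb{N}$. Suppose that $q=0$ and that at least one of the following holds: (i) $A=0$, $I_B\cup I_C\subseteq I_\beta\cup I_\gamma$, and $I_D\neq\emptyset$; (ii) $\alpha>0$, $A>0$, $I_B\cup I_C\subseteq I_\beta\cup I_\gamma$, and $I_D\neq\emptyset$; (iii) $I_D\cup I_E\subseteq I_\delta\cup I_\epsilon$ and $I_E\neq\emptyset$. Suppose moreover that there exists a positive integer $\eta$ such that for every sequence $\{c_m\}_{m=1}^\infty$ with $c_m\in I_\delta\cup I_\epsilon$ for all $m\ge 1$ there exist positive integers $N_1,N_2\le\eta$ such that $\sum_{m=N_1}^{N_2}c_m\in I_D\cup I_E$. Then there exist $M>0$ and $N\in\mathbb{N}$ such that every solution (from any non-negative initial conditions) satisfies $x_n\le M$ and $y_n\le M$ for all $n>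N$.
   Context: $\mathbb{N}=\{1,2,\dots\}$. Initial conditions are $x_{1-k},\dots,x_0,y_{1-k},\dots,y_0\ge 0$; a solution is a pair of sequences generated by the system from non-negative initial conditions for which all denominators are positive for every $n\in\mathbb{N}$. For each family of coefficients, the index set is the set of indices in $\{1,\dots,k\}$ with positive coefficient: $I_\beta=\{i:\beta_i>0\}$, $I_\gamma=\{i:\gamma_i>0\}$, $I_\delta=\{i:\delta_i>0\}$, $I_\epsilon=\{i:\epsilon_i>0\}$, $I_B=\{j:B_j>0\}$, $I_C=\{j:C_j>0\}$, $I_D=\{j:D_j>0\}$, $I_E=\{j:E_j>0\}$. A sum $\sum_{m=N_1}^{N_2}$ with $N_1>N_2$ is empty and equals $0$. *)

(* Defs.v *)
From mathcomp Require Import all_boot all_order all_algebra.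
From mathcomp Require Import all_classical all_reals.

Set Implicit Arguments.
Unset Strict Implicit.
Unset Printing Implicit Defensive.

Import Order.TTheory GRing.Theory Num.Theory.
Local Open Scope ring_scope.
Local Open Scope classical_set_scope.

(* A coefficient family indexed by {1, ..., k} is a function [nat -> R] of
   which only the values at 1, ..., k are ever used. Likewise a sequence
   indexed by n >= 1 - k is a function [int -> R] whose values below 1 - k
   are irrelevant. *)

Definition nonneg_coef (R : realType) (k : nat) (b : nat -> R) : Prop :=
  forall i : nat, (1 <= i <= k)%N -> 0 <= b i.

Definition index_set (R : realType) (k : nat) (b : nat -> R) : set nat :=
  [set i | (1 <= i <= k)%N /\ 0 < b i].

Definition affine_form (R : realType) (k : nat) (a : R) (b c : nat -> R)
    (x y : int -> R) (n : nat) : R :=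
  a + \sum_(1 <= i < k.+1) b i * x (n%:Z - i%:Z)
    + \sum_(1 <= i < k.+1) c i * y (n%:Z - i%:Z).

Definition is_solution (R : realType) (k : nat)
    (alpha : R) (beta gamma : nat -> R) (A : R) (B C : nat -> R)
    (p : R) (delta epsilon : nat -> R) (q : R) (D E : nat -> R)
    (x y : int -> R) : Prop :=
  (forall m : int, 1 - k%:Z <= m <= 0 -> 0 <= x m /\ 0 <= y m) /\
  (forall n : nat, (1 <= n)%N ->
     [/\ 0 < affine_form k A B C x y n,
         0 < affine_form k q D E x y n,
         x n%:Z = affine_form k alpha beta gamma x y n
                  / affine_form k A B C x y n
       & y n%:Z = affine_form k p delta epsilon x y n
                  / affine_form k q D E x y n]).

(* Main.v *)
Require Import Defs.
From mathcomp Require Import all_boot all_order all_algebra.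
From mathcomp Require Import all_classical all_reals.
From mathcomp Require Import zify lra.

Set Implicit Arguments.
Unset Strict Implicit.
Unset Printing Implicit Defensive.

Import Order.TTheory GRing.Theory Num.Theory.
Local Open Scope ring_scope.
Local Open Scope classical_set_scope.

(* By comparability both components may be measured by [y] alone. Whichever
   case holds, the inclusion of index sets bounds a ratio of two comparable
   forms away from zero, so [y n >= mu > 0] for all [n > k], with [mu]
   independent of the solution.  Since [q = 0],
     y_n <= K (1 + max_{i in S} y_{n-i}) / y_{n-t}   for every t in T,
   where [S = I_delta U I_epsilon] and [T = I_D U I_E].  Iterating along
   maximizing indices [c_1, c_2, ...], the lower bound makes [y] grow at most
   geometrically per step, and a block of partial sums in [T], which occurs
   within [eta] steps, provides a denominator that cancels this growth. *)

(** * Uniform constants and maximizers over finitely many indices *)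

Lemma exists_common_ratio (R : realFieldType) (k : nat) (f g : nat -> R) :
  (forall i, (i <= k)%N -> 0 <= f i) -> (forall i, (i <= k)%N -> 0 <= g i) ->
  (forall i, (i <= k)%N -> 0 < f i -> 0 < g i) ->
  exists2 r : R, 0 < r & forall i, (i <= k)%N -> r * f i <= g i.
Proof.
move=> f_ge0 g_ge0 fg.
have h_ge0 (i : 'I_k.+1) : 0 <= f i / g i by rewrite divr_ge0 ?f_ge0 ?g_ge0 // -ltnS.
have sum_ge0 : 0 <= \sum_(i < k.+1) f i / g i by rewrite sumr_ge0.
have den_gt0 : 0 < 1 + \sum_(i < k.+1) f i / g i by lra.
(* Each quotient [f i / g i] is at most the sum; where [g i = 0], also [f i = 0] and the quotient is
   [0] by convention. The [1] covers a vanishing sum. *)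
exists (1 + \sum_(i < k.+1) f i / g i)^-1; first by rewrite invr_gt0.
move=> i le_ik; have := f_ge0 i le_ik; rewrite le_eqVlt => /orP[/eqP <-|fi_gt0].
  by rewrite mulr0 g_ge0.
rewrite mulrC ler_pdivrMr // mulrC -ler_pdivrMr ?fg //.
have i_lt : (i < k.+1)%N by [].
rewrite (bigD1 (Ordinal i_lt)) //=.
have : 0 <= \sum_(j < k.+1 | j != Ordinal i_lt) f j / g j by rewrite sumr_ge0.
by lra.
Qed.

Lemma exists_argmax (R : realDomainType) (k : nat) (P : set nat) (g : nat -> R) :
  (forall i, P i -> (i <= k)%N) -> P !=set0 ->
  exists2 c, P c & forall i, P i -> g i <= g c.
Proof.
move=> P_le [i0 Pi0].
have i0_lt : (i0 < k.+1)%N by rewrite ltnS P_le.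
have Pi0' : `[< P (Ordinal i0_lt) >] by apply/asboolP.
have [c /asboolP Pc c_max] :=
  @Order.TotalTheory.arg_maxP _ _ _ (Ordinal i0_lt)
    (fun i : 'I_k.+1 => `[< P i >]) (fun i => g i) Pi0'.
exists c => // i Pi; have i_lt : (i < k.+1)%N by rewrite ltnS P_le.
by apply: (c_max (Ordinal i_lt)); apply/asboolP.
Qed.

(** * Descent along the maximizing indices *)

(* Following the maximizers [c] backwards from [n] gives indices
   [s 0 = n > s 1 > s 2 > ...] along which [1 + v] grows at most by a factor
   [L] per step.  If [s a - s b] lies in [T], the division by [v (s b)]
   cancels the growth of [v (s a.+1)] in terms of [v (s b)]. *)
Lemma bounded_of_partial_sums (R : realFieldType) (k eta : nat) (S T : set nat)
    (mu K : R) :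
  0 < mu -> 0 < K -> T !=set0 -> (forall i, S i -> (1 <= i <= k)%N) ->
  (forall i, T i -> (1 <= i <= k)%N) ->
  (forall c : nat -> nat, (forall m, (1 <= m)%N -> S (c m)) ->
     exists N1 N2 : nat, [/\ (1 <= N1 <= eta)%N, (1 <= N2 <= eta)%N
       & T (\sum_(N1 <= m < N2.+1) c m)%N]) ->
  exists M : R, forall v : nat -> R,
    (forall n, (k < n)%N -> mu <= v n) ->
    (forall n, (k < n)%N -> exists2 c, S c &
       forall t, T t -> v n * v (n - t)%N <= K * (1 + v (n - c)%N)) ->
    forall n, (eta.+1 * k < n)%N -> v n <= M.
Proof.
move=> mu_gt0 K_gt0 [t0 Tt0] S_le T_le sums.
(* Bounding the denominator below by [mu] gives [v n <= K / mu * (1 + v (n - c))]; adding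
   [1 <= 1 + v (n - c)] produces the factor [L]. *)
pose L := 1 + K / mu.
have L_ge1 : 1 <= L by rewrite lerDl divr_ge0 ?ltW.
have Lexp_ge1 j : 1 <= L ^+ j by rewrite exprn_ege1.
have Lexp_mono i j : (i <= j)%N -> L ^+ i <= L ^+ j by move=> ?; rewrite ler_weXn2l.
(* This will bound [v (s a)] at the start of the block: after division by [v (s N2)], the factor
   [1 + v (s N2)] becomes at most [1 + mu^-1]. *)
pose V := K * L ^+ eta * (1 + mu^-1).
exists (L ^+ eta * (1 + V)) => v v_ge v_step n n_gt.
(* For [m <= k] the index is an arbitrary element of [S], so that the chosen sequence lies in [S]
   everywhere, as [sums] demands. *)
have v_choice m : exists c, S c /\ ((k < m)%N ->
    forall t, T t -> v m * v (m - t)%N <= K * (1 + v (m - c)%N)).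
  case: (ltnP k m) => [lt_km|_].
    by have [c Sc Hc] := v_step m lt_km; exists c.
  by have [c Sc _] := v_step k.+1 (ltnSn k); exists c.
have [ch chP] := choice v_choice.
pose s := fix s j := if j is j'.+1 then (s j' - ch (s j'))%N else n.
have ch_le j : (1 <= ch j <= k)%N by apply: S_le; case: (chP j).
(* Each step descends by at most [k]. As [n > (eta + 1) * k], the path stays above [k] up to step
   [eta], hence without truncation, and above [2 * k] before it, leaving room to subtract an element
   of [T]. *)
have s_ge j : (n <= s j + j * k)%N.
  elim: j => [|j IH] /=; first by lia.
  by have := ch_le (s j); lia.
have s_gt j : (j <= eta)%N -> (k < s j)%N by move=> ?; have := s_ge j; nia.
have s_gt2 j : (j < eta)%N -> (k + k < s j)%N by move=> ?; have := s_ge j; nia.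
have step j : (j < eta)%N -> 1 + v (s j) <= L * (1 + v (s j.+1)).
  move=> lt_j; have gt_sj := s_gt2 j lt_j.
  have [_ /(_ ltac:(lia) t0 Tt0)] := chP (s j).
  have t0_le := T_le _ Tt0.
  have v1 : mu <= v (s j - t0)%N by apply: v_ge; lia.
  have v2 : mu <= v (s j) by apply: v_ge; lia.
  have v3 : mu <= v (s j.+1) by apply/v_ge/s_gt.
  move=> /= Hj; rewrite /= in v3.
  have : v (s j) <= K / mu * (1 + v (s j - ch (s j))%N).
    rewrite mulrAC ler_pdivlMr //; apply: le_trans Hj.
    by rewrite ler_pM2l //; lra.
  by rewrite /L mulrDl mul1r; lra.
have steps a d : (a + d <= eta)%N -> 1 + v (s a) <= L ^+ d * (1 + v (s (a + d)%N)).
  elim: d => [|d IH] le_eta; first by rewrite expr0 mul1r addn0.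
  apply: (le_trans (IH _)); first by lia.
  rewrite exprSr -mulrA addnS ler_pM2l; last by have := Lexp_ge1 d; lra.
  by apply: step; lia.
(* The hypothesis counts indices from 1 and the path from 0, hence the predecessor. *)
have [|N1 [N2 [N1_le N2_le TN]]] := sums (fun m => ch (s m.-1)).
  by move=> m _; case: (chP (s m.-1)).
(* An empty sum is [0], which is not in [T]. *)
have le_N : (N1 <= N2)%N.
  rewrite leqNgt; apply/negP => lt_N; have := T_le _ TN.
  by rewrite big_geq.
case: N1 N1_le le_N TN => [//|a] a_lt le_N TN.
have tele b : (a <= b <= eta)%N ->
    s a = (s b + \sum_(a.+1 <= m < b.+1) ch (s m.-1))%N.
  elim: b => [|b IH] le_b.
    by rewrite (_ : a = 0%N) ?big_geq ?addn0 //; lia.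
  case: (ltnP b a) => [lt_ba|le_ab].
    by rewrite (_ : a = b.+1) ?big_geq ?addn0 //; lia.
  rewrite big_nat_recr /=; last by lia.
  rewrite {1}IH; last by lia.
  by have := ch_le (s b); have := s_gt b ltac:(lia); lia.
have {tele}eq_s : (s a - \sum_(a.+1 <= m < N2.+1) ch (s m.-1))%N = s N2.
  by rewrite (tele N2) ?addnK //; lia.
have [_ /(_ (s_gt a ltac:(lia)) _ TN)] := chP (s a).
rewrite eq_s -/(s a.+1) => cancel.
have vb : mu <= v (s N2) by apply/v_ge/s_gt; lia.
have va : v (s a) <= V.
  have grow := steps a.+1 (N2 - a.+1)%N ltac:(lia).
  rewrite subnKC // in grow.
  have vb_gt0 : 0 < v (s N2) by lra.
  rewrite -(ler_pM2r vb_gt0); apply: (le_trans cancel).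
  rewrite /V -!mulrA ler_pM2l //; apply: (le_trans grow).
  apply: ler_pM => //; [by have := Lexp_ge1 (N2 - a.+1)%N; lra | by lra
    | by apply: Lexp_mono; lia |].
  rewrite mulrDl mul1r addrC lerD2l mulrC ler_pdivlMr //; lra.
(* It remains to carry the bound at [s a] back to [s 0 = n], at the cost of at most [L ^+ eta]. *)
have := steps 0%N a ltac:(lia); rewrite add0n [s 0%N]/= => first.
have V_ge0 : 0 <= V by apply: le_trans va; have := v_ge _ (s_gt a ltac:(lia)); lra.
have : L ^+ a * (1 + v (s a)) <= L ^+ eta * (1 + V).
  apply: ler_pM; [by have := Lexp_ge1 a; lra| |by apply: Lexp_mono; lia|by lra].
  by have := v_ge _ (s_gt a ltac:(lia)); lra.
by lra.
Qed.

(** * Affine forms in comparable sequences *)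

Lemma affine_form_bounds (R : realType) (k : nat) (M1 M2 a : R)
    (b c : nat -> R) (x y : int -> R) (n : nat) :
  nonneg_coef k b -> (k < n)%N ->
  (forall m : nat, (1 <= m)%N -> M1 * y m%:Z <= x m%:Z <= M2 * y m%:Z) ->
  a + \sum_(1 <= i < k.+1) (b i * M1 + c i) * y (n - i)%N%:Z
    <= affine_form k a b c x y n
    <= a + \sum_(1 <= i < k.+1) (b i * M2 + c i) * y (n - i)%N%:Z.
Proof.
move=> b_ge0 lt_kn cmp; rewrite /affine_form -addrA !lerD2l -big_split /=.
apply/andP; split; apply: ler_sum_nat => i i_le;
  have -> : n%:Z - i%:Z = (n - i)%N%:Z by lia.
- have /andP[le1 _] := cmp (n - i)%N ltac:(lia).
  by rewrite mulrDl lerD2r -mulrA ler_wpM2l // b_ge0.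
- have /andP[_ le2] := cmp (n - i)%N ltac:(lia).
  by rewrite mulrDl lerD2r -mulrA ler_wpM2l // b_ge0.
Qed.

(** Comparability replaces both forms by forms in [y] alone, with weights [b' i * M2 + c' i] and
    [b i * M1 + c i]. Such a weight is positive exactly on the union of the two index sets, so the
    inclusion allows a coefficientwise comparison; the constant term is treated as index 0. *)
Lemma affine_form_ratio (R : realType) (k : nat) (M1 M2 a a' : R)
    (b c b' c' : nat -> R) :
  0 < M1 -> 0 < M2 -> 0 <= a -> 0 <= a' -> (0 < a' -> 0 < a) ->
  nonneg_coef k b -> nonneg_coef k c -> nonneg_coef k b' -> nonneg_coef k c' ->
  index_set k b' `|` index_set k c' `<=` index_set k b `|` index_set k c ->
  exists2 r : R, 0 < r & forall (x y : int -> R) (n : nat), (k < n)%N ->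
    (forall m : nat, (1 <= m)%N -> M1 * y m%:Z <= x m%:Z <= M2 * y m%:Z) ->
    (forall m : nat, (1 <= m)%N -> 0 <= y m%:Z) ->
    r * affine_form k a' b' c' x y n <= affine_form k a b c x y n.
Proof.
move=> M1_gt0 M2_gt0 a_ge0 a'_ge0 aa' b_ge0 c_ge0 b'_ge0 c'_ge0 sub.
pose f i := if i is 0%N then a' else b' i * M2 + c' i.
pose g i := if i is 0%N then a else b i * M1 + c i.
have [] := @exists_common_ratio R k f g.
- by case=> [|i] le_ik //=; rewrite addr_ge0 ?mulr_ge0 ?b'_ge0 ?c'_ge0 // ltW.
- by case=> [|i] le_ik //=; rewrite addr_ge0 ?mulr_ge0 ?b_ge0 ?c_ge0 // ltW.
- case=> [|i] le_ik //= f_gt0.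
  have : (index_set k b' `|` index_set k c') i.+1.
    have := b'_ge0 i.+1 le_ik; rewrite le_eqVlt => /orP[/eqP b0|]; last by left.
    by right; split=> //; rewrite -b0 mul0r add0r in f_gt0.
  have := b_ge0 i.+1 le_ik; have := c_ge0 i.+1 le_ik => c0 b0 /sub[][_ h].
    by rewrite ltr_wpDr // mulr_gt0.
  by rewrite ltr_wpDl // mulr_ge0 // ltW.
move=> r r_gt0 fg; exists r => // x y n lt_kn cmp y_ge0.
have /andP[_ le'] := affine_form_bounds a' c' b'_ge0 lt_kn cmp.
have /andP[le _] := affine_form_bounds a c b_ge0 lt_kn cmp.
rewrite -(ler_pM2l r_gt0) in le'.
apply: (le_trans le'); apply: (le_trans _ le).
rewrite mulrDr; apply: lerD; first exact: (fg 0%N).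
rewrite mulr_sumr; apply: ler_sum_nat => i i_le.
rewrite mulrA ler_wpM2r ?y_ge0 ?subn_gt0 //; first by lia.
by case: i i_le => // i i_le; apply: (fg i.+1).
Qed.

Lemma is_solution_ge0 (R : realType) (k : nat) (alpha A p q : R)
    (beta gamma B C delta epsilon D E : nat -> R) (x y : int -> R) :
  0 <= alpha -> 0 <= p ->
  nonneg_coef k beta -> nonneg_coef k gamma ->
  nonneg_coef k delta -> nonneg_coef k epsilon ->
  is_solution k alpha beta gamma A B C p delta epsilon q D E x y ->
  forall m : int, 1 - k%:Z <= m -> 0 <= x m /\ 0 <= y m.
Proof.
move=> alpha_ge0 p_ge0 beta_ge0 gamma_ge0 delta_ge0 epsilon_ge0 [init sol].
have form_ge0 (a : R) b c n : 0 <= a -> nonneg_coef k b -> nonneg_coef k c ->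
    (forall m : int, 1 - k%:Z <= m < n%:Z -> 0 <= x m /\ 0 <= y m) ->
    (1 <= n)%N -> 0 <= affine_form k a b c x y n.
  move=> a_ge0 b_ge0 c_ge0 xy_ge0 n_ge1.
  rewrite /affine_form !big_nat !addr_ge0 // sumr_ge0 // => i i_le;
    by rewrite mulr_ge0 ?b_ge0 ?c_ge0 //; have [] := xy_ge0 (n%:Z - i%:Z) ltac:(lia).
have main (n : nat) : forall m : int, 1 - k%:Z <= m < n%:Z -> 0 <= x m /\ 0 <= y m.
  elim: n => [|n IH] m m_le; first by apply: init; lia.
  case: (ltP m n%:Z) => [lt_mn|le_nm]; first by apply: IH; lia.
  have {le_nm} -> : m = n%:Z by lia.
  case: n => [|n] in IH m_le *; first by apply: init; lia.
  have [den1 den2 -> ->] := sol n.+1 isT.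
  by split; apply: divr_ge0; by [exact: ltW | exact: form_ge0].
by move=> m m_le; apply: (main `|m|.+1); lia.
Qed.

(** * From the system to the scalar recursion *)

Theorem theorem4 (R : realType) (k : nat)
    (alpha A p q : R)
    (beta gamma B C delta epsilon D E : nat -> R)
    (k_gt0 : (1 <= k)%N)
    (alpha_ge0 : 0 <= alpha) (A_ge0 : 0 <= A) (p_ge0 : 0 <= p) (q_ge0 : 0 <= q)
    (beta_ge0 : nonneg_coef k beta) (gamma_ge0 : nonneg_coef k gamma)
    (B_ge0 : nonneg_coef k B) (C_ge0 : nonneg_coef k C)
    (delta_ge0 : nonneg_coef k delta) (epsilon_ge0 : nonneg_coef k epsilon)
    (D_ge0 : nonneg_coef k D) (E_ge0 : nonneg_coef k E)
    (comparable_xy : exists M1 M2 : R,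
      [/\ 0 < M1, 0 < M2
        & forall x y : int -> R,
            is_solution k alpha beta gamma A B C p delta epsilon q D E x y ->
            forall n : nat, (1 <= n)%N ->
              M1 * y n%:Z <= x n%:Z <= M2 * y n%:Z])
    (q_eq0 : q = 0)
    (cases :
      [\/ [/\ A = 0,
              index_set k B `|` index_set k C
                `<=` index_set k beta `|` index_set k gamma
            & index_set k D !=set0],
          [/\ 0 < alpha, 0 < A,
              index_set k B `|` index_set k C
                `<=` index_set k beta `|` index_set k gamma
            & index_set k D !=set0]
        | index_set k D `|` index_set k E
            `<=` index_set k delta `|` index_set k epsilon
          /\ index_set k E !=set0])
    (partial_sums : exists eta : nat, (1 <= eta)%N /\
      forall c : nat -> nat,
        (forall m : nat, (1 <= m)%N ->
           (index_set k delta `|` index_set k epsilon) (c m)) ->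
        exists N1 N2 : nat,
          [/\ (1 <= N1 <= eta)%N, (1 <= N2 <= eta)%N
            & (index_set k D `|` index_set k E)
                (\sum_(N1 <= m < N2.+1) c m)%N]) :
  exists (M : R) (N : nat),
    [/\ 0 < M, (1 <= N)%N
      & forall x y : int -> R,
          is_solution k alpha beta gamma A B C p delta epsilon q D E x y ->
          forall n : nat, (N < n)%N -> x n%:Z <= M /\ y n%:Z <= M].
Proof.
subst q; have [M1 [M2 [M1_gt0 M2_gt0 cmp]]] := comparable_xy.
have gt0_of_gt n N : (N < n)%N -> (1 <= n)%N by case: n.
have sub_gt0 n i : (k < n)%N -> (1 <= i <= k)%N -> (1 <= n - i)%N.
  by move=> lt_kn /andP[_ le_i]; rewrite subn_gt0 (leq_ltn_trans le_i).
have y_ge0 x y : is_solution k alpha beta gamma A B C p delta epsilon 0 D E x y ->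
    forall m : nat, (1 <= m)%N -> 0 <= y m%:Z.
  move=> sol m m_ge1.
  have := is_solution_ge0 alpha_ge0 p_ge0 beta_ge0 gamma_ge0 delta_ge0 epsilon_ge0 sol.
  by move=> /(_ m%:Z ltac:(lia))[].
have T_neq0 : index_set k D `|` index_set k E !=set0.
  by case: cases => [[_ _ [i Di]]|[_ _ _ [i Di]]|[_ [i Ei]]]; exists i; by [left | right].
have [mu mu_gt0 y_ge] : exists2 mu : R, 0 < mu & forall x y : int -> R,
    is_solution k alpha beta gamma A B C p delta epsilon 0 D E x y ->
    forall n : nat, (k < n)%N -> mu <= y n%:Z.
  (* In cases (i) and (ii) the first equation bounds [x] below by [r], and [x <= M2 * y] transfers
     this to [y]. *)
  have via_x : (0 < A -> 0 < alpha) -> index_set k B `|` index_set k C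
      `<=` index_set k beta `|` index_set k gamma ->
      exists2 mu : R, 0 < mu & forall x y : int -> R,
      is_solution k alpha beta gamma A B C p delta epsilon 0 D E x y ->
      forall n : nat, (k < n)%N -> mu <= y n%:Z.
    move=> Aalpha sub.
    have [r r_gt0 ratio] := affine_form_ratio M1_gt0 M2_gt0 alpha_ge0 A_ge0
      Aalpha beta_ge0 gamma_ge0 B_ge0 C_ge0 sub.
    exists (r / M2); first by rewrite divr_gt0.
    move=> x y sol n lt_kn.
    have /andP[_ le_x] := cmp x y sol n (gt0_of_gt _ _ lt_kn).
    rewrite ler_pdivrMr // mulrC; apply: le_trans le_x.
    have [den_gt0 _ -> _] := sol.2 n (gt0_of_gt _ _ lt_kn).
    by rewrite ler_pdivlMr //; apply: ratio => //; [apply: cmp | apply: y_ge0 sol].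
  case: cases => [[A0 sub _]|[alpha_gt0 _ sub _]|[sub _]].
  - by apply: via_x => //; rewrite A0 ltxx.
  - exact: via_x.
  have [|r r_gt0 ratio] := affine_form_ratio M1_gt0 M2_gt0 p_ge0 q_ge0 _
      delta_ge0 epsilon_ge0 D_ge0 E_ge0 sub; first by rewrite ltxx.
  exists r => // x y sol n lt_kn.
  have [_ den_gt0 _ ->] := sol.2 n (gt0_of_gt _ _ lt_kn).
  by rewrite ler_pdivlMr //; apply: ratio => //; [apply: cmp | apply: y_ge0 sol].
set S := index_set k delta `|` index_set k epsilon in partial_sums *.
set T := index_set k D `|` index_set k E in partial_sums T_neq0 *.
have S_le i : S i -> (1 <= i <= k)%N by case=> [][].
have T_le i : T i -> (1 <= i <= k)%N by case=> [][].
pose h i := D i * M1 + E i.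
have h_ge0 i : (1 <= i <= k)%N -> 0 <= h i.
  by move=> le_i; rewrite addr_ge0 ?E_ge0 // mulr_ge0 ?D_ge0 // ltW.
(* A positive minimum of [h] on [T], obtained by comparing the indicator of [T] with [h] restricted
   to [T]. *)
have [d d_gt0 d_le] : exists2 d : R, 0 < d & forall t, T t -> d <= h t.
  have [||i|r r_gt0 Hr] := @exists_common_ratio R k
      (fun i => if `[< T i >] then 1 else 0) (fun i => if `[< T i >] then h i else 0).
  - by move=> i _; case: ifP.
  - by move=> i _; case: ifP => // /asboolP/T_le/h_ge0.
  - move=> _; case: ifP => [/asboolP Ti _|_]; last by rewrite ltxx.
    have le_i := T_le _ Ti.
    case: Ti => [][_ gt0]; first by rewrite ltr_wpDr ?E_ge0 ?mulr_gt0.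
    by rewrite ltr_wpDl // mulr_ge0 ?D_ge0 // ltW.
  exists r => // t Tt; have /andP[_ le_t] := T_le t Tt.
  by have := Hr t le_t; rewrite asboolT // mulr1.
(* Multiply the second equation by its denominator; since [q = 0] and all terms are non-negative,
   keep only the term of index [t]. *)
have step x y : is_solution k alpha beta gamma A B C p delta epsilon 0 D E x y ->
    forall n : nat, (k < n)%N -> forall t, T t ->
    y n%:Z * y (n - t)%N%:Z <=
      (p + \sum_(1 <= i < k.+1) (delta i * M2 + epsilon i) * y (n - i)%N%:Z) / d.
  move=> sol n lt_kn t Tt; have t_le := T_le t Tt.
  have [_ den_gt0 _ eq_y] := sol.2 n (gt0_of_gt _ _ lt_kn).
  have /andP[le_den _] := affine_form_bounds 0 E D_ge0 lt_kn (cmp x y sol).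
  have /andP[_ le_num] := affine_form_bounds p epsilon delta_ge0 lt_kn (cmp x y sol).
  rewrite ler_pdivlMr //; apply: le_trans le_num.
  have -> : affine_form k p delta epsilon x y n
      = y n%:Z * affine_form k 0 D E x y n by rewrite eq_y divfK // gt_eqF.
  rewrite -mulrA ler_wpM2l ?(y_ge0 _ _ sol) ?(gt0_of_gt _ _ lt_kn) //.
  apply: le_trans le_den; rewrite add0r.
  rewrite (bigD1_seq t) ?mem_index_iota ?iota_uniq //=.
  rewrite mulrC -[leLHS]addr0 lerD //.
    by rewrite ler_wpM2r ?d_le // (y_ge0 _ _ sol) ?sub_gt0.
  rewrite big_seq_cond sumr_ge0 // => i; rewrite mem_index_iota => /andP[i_le _].
  by rewrite mulr_ge0 ?h_ge0 // (y_ge0 _ _ sol) ?sub_gt0.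
pose F := \sum_(1 <= i < k.+1) (delta i * M2 + epsilon i).
have f_ge0 i : (1 <= i <= k)%N -> 0 <= delta i * M2 + epsilon i.
  by move=> le_i; rewrite addr_ge0 ?epsilon_ge0 // mulr_ge0 ?delta_ge0 // ltW.
have F_ge0 : 0 <= F by rewrite /F big_nat sumr_ge0.
have f_eq0 i : (1 <= i <= k)%N -> ~ S i -> delta i * M2 + epsilon i = 0.
  move=> le_i nS; have := delta_ge0 i le_i; have := epsilon_ge0 i le_i.
  rewrite !le_eqVlt => /orP[/eqP <-|e_gt0]; last by case: nS; right.
  by move=> /orP[/eqP <-|d_gt]; [rewrite mul0r addr0 | case: nS; left].
(* Indices outside [S] have weight zero, so the numerator is at most [p + F * Y], where [Y] is the
   maximum over [S]; the extra [1] makes [K] positive. *)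
pose K := (p + F + 1) / d.
have K_gt0 : 0 < K by rewrite divr_gt0 //; lra.
have [M [N y_le]] : exists (M : R) (N : nat), forall x y : int -> R,
    is_solution k alpha beta gamma A B C p delta epsilon 0 D E x y ->
    forall n : nat, (N < n)%N -> y n%:Z <= M.
  have [S_neq0|S_eq0] := pselect (S !=set0).
    have [eta [_ sums]] := partial_sums.
    have [M bd] := bounded_of_partial_sums mu_gt0 K_gt0 T_neq0 S_le T_le sums.
    exists M, (eta.+1 * k)%N => x y sol.
    apply: (bd (fun n => y n%:Z)) => [n lt_kn|n lt_kn]; first exact: y_ge sol _ _.
    have [c Sc c_max] := exists_argmax (fun i => y (n - i)%N%:Z)
      (fun i Si => proj2 (andP (S_le i Si))) S_neq0.
    exists c => // t Tt; apply: (le_trans (step _ _ sol _ lt_kn _ Tt)).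
    have yc_ge0 : 0 <= y (n - c)%N%:Z by rewrite (y_ge0 _ _ sol) ?sub_gt0 ?S_le.
    rewrite /K mulrAC ler_pM2r ?invr_gt0 //.
    apply: (@le_trans _ _ (p + F * y (n - c)%N%:Z)); last by nra.
    rewrite lerD2l /F mulr_suml; apply: ler_sum_nat => i i_le.
    have [Si|nS] := pselect (S i); last by rewrite f_eq0 ?mul0r.
    by rewrite ler_wpM2l ?f_ge0 // c_max.
  (* With [S] empty there is no index to follow: the numerator is just [p], and [n > 2 * k] ensures
     [mu <= y (n - t)]. *)
  have [t Tt] := T_neq0; have /andP[_ t_le] := T_le t Tt.
  exists (p / d / mu), (k + k)%N => x y sol n lt_n.
  have lt_kn : (k < n)%N := leq_ltn_trans (leq_addr k k) lt_n.
  have lt_k_sub : (k < n - t)%N by rewrite ltn_subRL (leq_ltn_trans _ lt_n) ?leq_add2r.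
  rewrite ler_pdivlMr //.
  apply: (@le_trans _ _ (y n%:Z * y (n - t)%N%:Z)).
    by rewrite ler_wpM2l ?(y_ge0 _ _ sol) ?(y_ge _ _ sol) ?(gt0_of_gt _ _ lt_kn).
  apply: (le_trans (step _ _ sol n lt_kn t Tt)).
  rewrite big_nat big1 ?addr0 // => i i_le.
  by rewrite f_eq0 ?mul0r // => Si; apply: S_eq0; exists i.
(* [M] has no known sign, hence the absolute value; [M2] times it bounds [x]. *)
exists (1 + `|M| + M2 * `|M|), N.+1.
have absM := ler_norm M; have absM_ge0 := normr_ge0 M.
have M2M_ge0 : 0 <= M2 * `|M| by rewrite mulr_ge0 // ltW.
split=> // [|x y sol n lt_n]; first by lra.
have le_y := y_le x y sol n (ltnW lt_n).
have /andP[_ le_x] := cmp x y sol n (gt0_of_gt _ _ lt_n).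
have : M2 * y n%:Z <= M2 * `|M| by rewrite ler_pM2l //; lra.
by split; lra.
Qed.
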